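(* Let $k$ be an effective field, $I$ an ideal of $k[y_1,\ldots,y_m,x_1,\ldots,x_n]$, $J=I\cap k[y_1,\ldots,y_m]$, $B=k[y_1,\ldots,y_m,x_1,\ldots,x_n]/I$ and $A=k[y_1,\ldots,y_m]/J$. Let $\mathcal{G}$ be a Gröbner basis of $I$ with respect to the block order $T=T_x>T_y$. Then the finiteness of the morphism $\operatorname{Spec}B\to\operatorname{Spec}A$ can be effectively determined. Especially, the following are equivalent: (1) $B$ is a finite $A$-module; (2) there are monic polynomials $\varphi_i(\lambda)\in A[\lambda]$, $i=1,\ldots,n$, such that $\varphi_i(x_i)=0$ in $B$; (3) for each $x_i$ there is $g_i\in\mathcal{G}$ such that the leading monomial $\mathtt{LM}_T(g_i)$ is a power of $x_i$.
   Context: An effective field is one over which Gröbner basis computations can be carried out algorithmically. $T_x$ and $T_y$ are monomial orders on the monomials in $x_1,\ldots,x_n$ and $y_1,\ldots,y_m$ respectively; the block order $T=T_x>T_y$ compares first the $x$-parts by $T_x$ and, in case of equality, the $y$-parts by $T_y$. $\mathtt{LM}_T(g)$ is the leading monomial of $g$ with respect to $T$. A power of $x_i$ is a monomial $x_i^\alpha$ with $\alpha\ge0$. $B$ is an $A$-algebra via the inclusion $k[y_1,\ldots,y_m]\subseteq k[y_1,\ldots,y_m,x_1,\ldots,x_n]$. *)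

(* Defs.v *)
From HB Require Import structures.
From mathcomp Require Import all_boot all_order all_algebra.
From mathcomp Require Import mpoly.

Set Implicit Arguments.
Unset Strict Implicit.
Unset Printing Implicit Defensive.

Import GRing.Theory.
Local Open Scope ring_scope.
Local Open Scope quotient_scope.

(* The library's [idealr] only covers proper ideals; here the unit ideal is   *)
(* allowed, so quotient rings may be zero rings ([comPzRingType]).            *)

HB.mixin Record isMulAbsorbing (R : comPzRingType) (S : R -> bool) := {
  ideal_mull : forall a u : R, u \in S -> a * u \in S
}.

#[short(type="ideal")]
HB.structure Definition Ideal (R : comPzRingType) :=
  {S of GRing.ZmodClosed R S & isMulAbsorbing R S}.

Section QuotientRing.
Variables (R : comPzRingType) (I : ideal R).

Definition quot_ring : Type := Quotient.quot I.
HB.instance Definition _ := GRing.Zmodule.on quot_ring.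

Definition quot_proj (x : R) : quot_ring := \pi_(Quotient.quot I) x.
Definition quot_repr (a : quot_ring) : R := repr (a : Quotient.quot I).

Lemma quot_reprK : cancel quot_repr quot_proj.
Proof. by move=> a; exact: reprK. Qed.

Lemma quot_proj_eq x y : (quot_proj x == quot_proj y) = (x - y \in I).
Proof. by rewrite Quotient.idealrBE. Qed.

Lemma quot_projP x y : x - y \in I -> quot_proj x = quot_proj y.
Proof. by rewrite -quot_proj_eq => /eqP. Qed.

Lemma quot_reprB x : quot_repr (quot_proj x) - x \in I.
Proof. by rewrite -quot_proj_eq quot_reprK. Qed.

Fact quot_proj_is_zmod_morphism : zmod_morphism quot_proj.
Proof. by move=> x y; rewrite /quot_proj raddfB. Qed.
HB.instance Definition _ :=
  GRing.isZmodMorphism.Build R quot_ring quot_proj quot_proj_is_zmod_morphism.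

Definition quot_one : quot_ring := quot_proj 1.
Definition quot_mul (a b : quot_ring) : quot_ring :=
  quot_proj (quot_repr a * quot_repr b).

Lemma quot_projM x y : quot_proj (x * y) = quot_mul (quot_proj x) (quot_proj y).
Proof.
apply: esym; apply: quot_projP.
set a := quot_repr _; set b := quot_repr _.
have -> : a * b - x * y = b * (a - x) + x * (b - y).
  by rewrite !mulrBr [b * a]mulrC [b * x]mulrC addrA subrK.
by rewrite rpredD // ideal_mull // quot_reprB.
Qed.

Fact quot_mulA : associative quot_mul.
Proof.
move=> a b c; rewrite -[a]quot_reprK -[b]quot_reprK -[c]quot_reprK.
by rewrite -!quot_projM mulrA.
Qed.

Fact quot_mulC : commutative quot_mul.
Proof. by move=> a b; rewrite /quot_mul mulrC. Qed.

Fact quot_mul1 : left_id quot_one quot_mul.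
Proof.
by move=> a; rewrite -[a]quot_reprK /quot_one -quot_projM mul1r.
Qed.

Fact quot_mulDl : left_distributive quot_mul +%R.
Proof.
move=> a b c; rewrite -[a]quot_reprK -[b]quot_reprK -[c]quot_reprK.
by rewrite -raddfD -!quot_projM mulrDl raddfD.
Qed.

HB.instance Definition _ := GRing.Zmodule_isComPzRing.Build quot_ring
  quot_mulA quot_mulC quot_mul1 quot_mulDl.

Fact quot_proj_is_monoid_morphism : monoid_morphism quot_proj.
Proof. by split=> // x y; rewrite quot_projM. Qed.
HB.instance Definition _ := GRing.isMonoidMorphism.Build R quot_ring quot_proj
  quot_proj_is_monoid_morphism.

End QuotientRing.

Arguments quot_proj {R} I x.

Section Contraction.
Variables (R S : comPzRingType) (f : {rmorphism R -> S}) (I : ideal S).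

Definition contraction_pred : {pred R} := fun x => f x \in I.

Fact contraction_zmod_closed : zmod_closed contraction_pred.
Proof.
split=> [|x y xI yI]; first by rewrite unfold_in /contraction_pred rmorph0 rpred0.
by rewrite unfold_in /contraction_pred rmorphB rpredB.
Qed.
HB.instance Definition _ :=
  GRing.isZmodClosed.Build R contraction_pred contraction_zmod_closed.

Fact contraction_mull (a u : R) : u \in contraction_pred -> a * u \in contraction_pred.
Proof.
by move=> uI; rewrite unfold_in /contraction_pred rmorphM ideal_mull.
Qed.
HB.instance Definition _ := isMulAbsorbing.Build R contraction_pred contraction_mull.

Definition contraction : ideal R := contraction_pred.

Lemma mem_contraction x : (x \in contraction) = (f x \in I).
Proof. by []. Qed.

Definition quot_map (a : quot_ring contraction) : quot_ring I :=
  quot_proj I (f (quot_repr a)).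

Lemma quot_map_proj x : quot_map (quot_proj contraction x) = quot_proj I (f x).
Proof.
by apply: quot_projP; rewrite -rmorphB -mem_contraction quot_reprB.
Qed.

Fact quot_map_is_zmod_morphism : zmod_morphism quot_map.
Proof.
move=> a b; rewrite -[a]quot_reprK -[b]quot_reprK -raddfB !quot_map_proj.
by rewrite !raddfB.
Qed.
HB.instance Definition _ := GRing.isZmodMorphism.Build
  (quot_ring contraction) (quot_ring I) quot_map quot_map_is_zmod_morphism.

Fact quot_map_is_monoid_morphism : monoid_morphism quot_map.
Proof.
split=> [|a b]; first by rewrite quot_map_proj rmorph1.
rewrite -[a]quot_reprK -[b]quot_reprK -rmorphM !quot_map_proj.
by rewrite !rmorphM.
Qed.
HB.instance Definition _ := GRing.isMonoidMorphism.Build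
  (quot_ring contraction) (quot_ring I) quot_map quot_map_is_monoid_morphism.

End Contraction.

Arguments quot_map {R S} f I a.

(* The codomain B of a ring morphism f : A -> B, seen as an A-module.         *)

Definition module_via (A B : comPzRingType) (f : {rmorphism A -> B}) : Type := B.

Section ModuleVia.
Variables (A B : comPzRingType) (f : {rmorphism A -> B}).

HB.instance Definition _ := GRing.ComPzRing.copy (module_via f) B.

Definition via_scale (a : A) (b : module_via f) : module_via f :=
  (f a : module_via f) * b.

Fact via_scaleA a b v : via_scale a (via_scale b v) = via_scale (a * b) v.
Proof. by rewrite /via_scale rmorphM mulrA. Qed.
Fact via_scale1 : left_id 1 via_scale.
Proof. by move=> v; rewrite /via_scale rmorph1 mul1r. Qed.
Fact via_scaleDr : right_distributive via_scale +%R.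
Proof. by move=> a u v; rewrite /via_scale mulrDr. Qed.
Fact via_scaleDl v : {morph via_scale^~ v : a b / a + b}.
Proof. by move=> a b; rewrite /via_scale rmorphD mulrDl. Qed.

HB.instance Definition _ := GRing.Zmodule_isLmodule.Build A (module_via f)
  via_scaleA via_scale1 via_scaleDr via_scaleDl.

End ModuleVia.

Definition finite_module (A : pzRingType) (M : lmodType A) : Prop :=
  exists s : seq M, forall v : M, exists c : 'I_(size s) -> A,
    v = \sum_(j < size s) c j *: s`_j.

(* [monic_horner f c b] is the value at b of the monic polynomial             *)
(*   X^d + c_(d-1) X^(d-1) + ... + c_0,   d = size c,                         *)
(* with coefficients in A acting on B through f.  [{poly A}] is not available *)
(* because A may be the zero ring.                                            *)
Definition monic_horner (A B : comPzRingType) (f : {rmorphism A -> B})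
    (c : seq A) (b : B) : B :=
  b ^+ size c + \sum_(j < size c) f c`_j * b ^+ j.

Definition ideal_span (R : comPzRingType) (F : seq R) (p : R) : Prop :=
  exists c : 'I_(size F) -> R, p = \sum_(j < size F) c j * F`_j.

Definition monomial_order n (T : rel 'X_{1..n}) : Prop :=
  [/\ total T, antisymmetric T, transitive T,
      forall u, T 0%MM u
    & forall u v w, T u v -> T (u + w)%MM (v + w)%MM].

(* Leading monomial for T, with the same convention as [mlead]: it is 0%MM    *)
(* (the monomial 1) for the zero polynomial, which therefore has to be        *)
(* excluded explicitly below.                                                 *)
Definition LM n (K : nzRingType) (T : rel 'X_{1..n}) (p : {mpoly K[n]}) :
    'X_{1..n} :=
  \big[(fun u v => if T u v then v else u)/0%MM]_(u <- msupp p) u.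

Definition groebner_basis n (K : fieldType) (T : rel 'X_{1..n})
    (I : ideal {mpoly K[n]}) (G : seq {mpoly K[n]}) : Prop :=
  {subset G <= I} /\
  forall f : {mpoly K[n]}, f \in I -> f != 0 ->
    ideal_span [seq 'X_[LM T g] | g <- G & g != 0] ('X_[LM T f] : {mpoly K[n]}).

(* A field together with an algorithm computing Groebner bases.               *)
Record effective_field := EffectiveField {
  effective_field_sort :> fieldType;
  groebner : forall n, rel 'X_{1..n} ->
    seq {mpoly effective_field_sort[n]} -> seq {mpoly effective_field_sort[n]};
  groebnerP : forall n (T : rel 'X_{1..n}) (F : seq {mpoly effective_field_sort[n]})
      (I : ideal {mpoly effective_field_sort[n]}),
    monomial_order T -> (forall p, p \in I <-> ideal_span F p) ->
    groebner_basis T I (groebner T F)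
}.

(* In {mpoly K[m + n]} the first m variables are y_1, ..., y_m and the last n *)
(* are x_1, ..., x_n.                                                         *)

Section Blocks.
Variables m n : nat.

Definition ypart (u : 'X_{1..m + n}) : 'X_{1..m} :=
  [multinom u (lshift n j) | j < m].
Definition xpart (u : 'X_{1..m + n}) : 'X_{1..n} :=
  [multinom u (rshift m i) | i < n].

Definition block_order (Tx : rel 'X_{1..n}) (Ty : rel 'X_{1..m}) :
    rel 'X_{1..m + n} :=
  fun u v => if xpart u == xpart v then Ty (ypart u) (ypart v)
             else Tx (xpart u) (xpart v).

Definition is_xpower (i : 'I_n) (u : 'X_{1..m + n}) : Prop :=
  exists alpha : nat, u = (U_(rshift m i) *+ alpha)%MM.

Variable K : fieldType.

Definition yincl : {rmorphism {mpoly K[m]} -> {mpoly K[m + n]}} :=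
  comp_mpoly [tuple 'X_(lshift n j) | j < m].

Section Rings.
Variable I : ideal {mpoly K[m + n]}.

Definition ringA : comPzRingType := quot_ring (contraction yincl I).
Definition ringB : comPzRingType := quot_ring I.
Definition structAB : {rmorphism ringA -> ringB} := quot_map yincl I.
Definition Bmod : lmodType ringA := module_via structAB.
Definition xclass (i : 'I_n) : ringB := quot_proj I 'X_(rshift m i).

End Rings.

(* The decision procedure for finiteness, to be run on a Groebner basis of I  *)
(* for the block order; I itself is then given by finitely many generators.   *)
Definition finiteness_test (Tx : rel 'X_{1..n}) (Ty : rel 'X_{1..m})
    (G : seq {mpoly K[m + n]}) : bool :=
  [forall i : 'I_n, has (fun g : {mpoly K[m + n]} =>
     let u := LM (block_order Tx Ty) g in
     (g != 0) && (u == U_(rshift m i) *+ u (rshift m i))%MM) G].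

End Blocks.

(* Main.v *)
(** For (1) => (2), the determinant trick over k[y] yields a monic relation for
    x_i; for the block order the leading monomial of that relation, an element
    of I, is x_i^d, so some LM(g) with g in G divides it and is itself a power
    of x_i.  For (3) => (1), the monomials x^u not divisible by any of the
    leading powers x_i^(a_i) are finitely many; every other x^u is rewritten
    modulo I into terms with strictly T_x-smaller x-part, and this terminates
    because T_x is well-founded by Dickson's lemma. *)

Require Import Defs.
From HB Require Import structures.
From mathcomp Require Import all_boot all_order all_algebra.
From mathcomp Require Import mpoly.
From Stdlib Require Import ClassicalEpsilon.
Set Implicit Arguments.
Unset Strict Implicit.
Unset Printing Implicit Defensive.
Import GRing.Theory.
Local Open Scope ring_scope.

(** * Dickson's lemma *)

Lemma nat_tail_min (a : nat -> nat) (N : nat) :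
  exists i, (N <= i)%N /\ forall j, (i <= j)%N -> (a i <= a j)%N.
Proof.
(* Descent on a strict bound [b] of [a N]: a smaller value at a later index restarts the search from
   that index. *)
have [b le_b] := ubnP (a N); elim: b => // b IH in N le_b *.
have [leN|] := classic (forall j, (N <= j)%N -> (a N <= a j)%N); first by exists N.
move=> /not_all_ex_not[j] nle.
have [le_Nj /negP] := imply_to_and _ _ nle; rewrite -ltnNge => lt_ajN.
have [i [le_ji min_i]] := IH j (leq_trans lt_ajN le_b).
by exists i; split=> //; apply: leq_trans le_ji.
Qed.

(** Each index is chosen where [a] attains its minimum over the tail beyond the previous index, so
    later values cannot drop below it. *)
Lemma nondecreasing_subseq (a : nat -> nat) :
  exists phi : nat -> nat, {homo phi : i j / (i < j)%N} /\
    {homo (fun i => a (phi i)) : i j / (i <= j)%N}.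
Proof.
pose f N := proj1_sig (constructive_indefinite_description _ (nat_tail_min a N)).
have fP N : (N <= f N)%N /\ forall j, (f N <= j)%N -> (a (f N) <= a j)%N.
  exact: proj2_sig (constructive_indefinite_description _ (nat_tail_min a N)).
pose phi k := iter k (fun N => f N.+1) (f 0%N).
have phi_lt : {homo phi : i j / (i < j)%N}.
  by apply: homo_ltn => [? ? ?|i]; [exact: ltn_trans | case: (fP (phi i).+1)].
exists phi; split=> //; apply: (@homo_leq _ (a \o phi) leq) => [//|? ? ?|i].
  exact: leq_trans.
have min_i : forall j, (phi i <= j)%N -> (a (phi i) <= a j)%N.
  by case: i => [|i]; [case: (fP 0%N) | case: (fP (phi i).+1)].
exact/min_i/ltnW/phi_lt.
Qed.

(** The subsequence is refined one coordinate at a time; once all [n] coordinates are nondecreasing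
    along it, its first two terms are comparable. *)
Lemma dickson n (a : nat -> 'X_{1..n}) :
  exists i j, (i < j)%N /\ (a i <= a j)%MM.
Proof.
suff /(_ n) [phi [phi_lt phi_le]] k : exists phi : nat -> nat,
    {homo phi : i j / (i < j)%N} /\
    forall l : 'I_n, (l < k)%N -> {homo (fun i => a (phi i) l) : i j / (i <= j)%N}.
  exists (phi 0%N), (phi 1%N); split; first exact: phi_lt.
  by apply/mnm_lepP => l; apply: phi_le.
elim: k => [|k [phi [phi_lt phi_le]]]; first by exists id; split.
have [le_nk|lt_kn] := leqP n k.
  by exists phi; split=> // l _; apply/phi_le/(leq_trans _ le_nk).
have [psi [psi_lt psi_le]] := nondecreasing_subseq (fun i => a (phi i) (Ordinal lt_kn)).
exists (phi \o psi); split=> [i j /psi_lt /phi_lt //|l].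
rewrite ltnS leq_eqVlt => /predU1P[eq_lk|lt_lk] i j le_ij /=.
  by have -> : l = Ordinal lt_kn; [exact: val_inj | exact: psi_le].
by apply: phi_le => //; apply: ltnW_homo le_ij.
Qed.

(** * Monomial orders and leading monomials *)

Section MonomialOrder.
Variables (n : nat) (T : rel 'X_{1..n}).
Hypothesis hT : monomial_order T.

Definition strict_order : rel 'X_{1..n} := fun u v => T u v && (u != v).

Lemma monomial_order_refl : reflexive T.
Proof. by case: hT => tot _ _ _ _ u; have := tot u u; rewrite orbb. Qed.

Lemma monomial_order_lem (u v : 'X_{1..n}) : (u <= v)%MM -> T u v.
Proof.
case: hT => _ _ _ T0 TD /submK <-.
by have := TD 0%MM (v - u)%MM u (T0 _); rewrite add0m.
Qed.

Lemma strict_orderD (u v w : 'X_{1..n}) :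
  strict_order u v -> strict_order (u + w)%MM (v + w)%MM.
Proof.
by case: hT => _ _ _ _ TD /andP[Tuv neq_uv]; rewrite /strict_order TD // eqm_add2r.
Qed.

(** A non-accessible monomial would start, by choice, an infinite strictly descending sequence.
    Dickson's lemma finds in it an earlier term dividing a later one, hence below it for [T],
    against the descent. *)
Lemma strict_order_wf : well_founded strict_order.
Proof.
case: (hT) => Ttot Tanti Ttr _ _ u; apply: NNPP => nAu.
have step (x : {u | ~ Acc strict_order u}) : exists y : {u | ~ Acc strict_order u},
    strict_order (proj1_sig y) (proj1_sig x).
  case: x => x nAx; apply: NNPP => nex; apply: (nAx); constructor => y lt_yx.
  by apply: NNPP => nAy; apply: nex; exists (exist _ y nAy).
pose f x := proj1_sig (constructive_indefinite_description _ (step x)).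
have fP x : strict_order (proj1_sig (f x)) (proj1_sig x).
  exact: proj2_sig (constructive_indefinite_description _ (step x)).
pose s k := proj1_sig (iter k f (exist _ u nAu)).
have s_desc : {homo s : i j / (i < j)%N >-> strict_order j i}.
  apply: homo_ltn => [v w x lt_vw lt_xv|i]; last exact: fP.
  move: lt_vw lt_xv => /andP[Tvw neq_vw] /andP[Txv neq_xv].
  rewrite /strict_order (Ttr _ _ _ Txv Tvw); apply: contraNneq neq_xv => eq_xw.
  by apply/eqP/Tanti; rewrite Txv eq_xw Tvw.
have [i [j [lt_ij /monomial_order_lem Tij]]] := dickson s.
have /andP[Tji /eqP[]] := s_desc _ _ lt_ij.
by apply: Tanti; rewrite Tji.
Qed.

Variable K : nzRingType.

Lemma LM_max (p : {mpoly K[n]}) u : u \in msupp p -> T u (LM T p).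
Proof.
case: hT => Ttot _ Ttr _ _; rewrite /LM; elim: (msupp p) => // v s.
set w := bigop _ _ _ => IH.
rewrite big_cons -/w inE => /predU1P[->|/IH Tus].
  by case: ifP => // _; exact: monomial_order_refl.
by case: ifP => // /negbT nT; apply: Ttr Tus _; move: (Ttot v w); rewrite (negPf nT).
Qed.

Lemma LM_msupp (p : {mpoly K[n]}) : p != 0 -> LM T p \in msupp p.
Proof.
case: (hT) => _ Tanti _ T0 _; rewrite -msupp_eq0 /LM; case: (msupp p) => // v s _.
elim: s v => [|w s IH] v; rewrite big_cons.
  (* The initial value [0%MM] of the fold need not be in the support, but as the least monomial it
     replaces [v] only when [v] equals it. *)
  rewrite big_nil mem_seq1; case: ifP => // Tv0.
  by apply/eqP/Tanti; rewrite T0 Tv0.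
by case: ifP => _; rewrite in_cons ?IH ?orbT ?eqxx.
Qed.

Lemma LM_unique (p : {mpoly K[n]}) u :
  u \in msupp p -> (forall v, v \in msupp p -> T v u) -> LM T p = u.
Proof.
move=> pu umax; case: (hT) => _ Tanti _ _ _; apply: Tanti.
by rewrite LM_max // umax ?LM_msupp // -msupp_eq0; case: msupp pu.
Qed.

End MonomialOrder.

(** * Monomial ideals and the determinant trick *)

(** Some summand of the combination must contain [w], and all monomials of a multiple of ['X_[e g]]
    are divisible by [e g]. *)
Lemma ideal_span_mpolyX n (K : comNzRingType) (J : eqType) (s : seq J)
    (e : J -> 'X_{1..n}) (w : 'X_{1..n}) :
  ideal_span [seq 'X_[e g] | g <- s] ('X_[w] : {mpoly K[n]}) ->
  exists2 g, g \in s & (e g <= w)%MM.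
Proof.
case=> c Xw; have: ('X_[w] : {mpoly K[n]})@_w != 0 by rewrite mcoeffX eqxx oner_eq0.
rewrite {1}Xw raddf_sum /= => nz.
have [j nzj] : exists j : 'I_(size [seq 'X_[e g] : {mpoly K[n]} | g <- s]),
    (c j * [seq 'X_[e g] | g <- s]`_j)@_w != 0.
  apply/existsP; apply: contraNT nz => /existsPn nz.
  by rewrite big1 // => j _; apply/eqP/negPn.
move: nzj; rewrite -mcoeff_msupp.
have lt_j : (j < size s)%N by rewrite -(size_map (fun g => 'X_[e g] : {mpoly K[n]})).
case: s => // g0 s in c Xw nz j lt_j *.
rewrite (nth_map g0) // (perm_mem (msuppMX _ _)) => /mapP[u _ ->].
by exists (nth g0 (g0 :: s) j); rewrite ?mem_nth // lem_addr.
Qed.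

Lemma idealr_sum (R : comPzRingType) (I : ideal R) (J : finType) (a b : J -> R) :
  (forall j, b j \in I) -> \sum_j a j * b j \in I.
Proof. by move=> Ib; apply: rpred_sum => j _; apply: ideal_mull. Qed.

Lemma eq_idealP (R : comPzRingType) (I : ideal R) (x y : R) :
  reflect (quot_proj I x = quot_proj I y) (x - y \in I).
Proof. by rewrite -quot_proj_eq; apply: eqP. Qed.

(** The list keeps the [d] lower coefficients of the characteristic polynomial; its leading term is
    the monic one implicit in [monic_horner]. *)
Lemma monic_horner_char_poly (R S : comNzRingType) (f : {rmorphism R -> S})
    d (M : 'M[R]_d) (x : S) :
  monic_horner f [seq (char_poly M)`_j | j <- iota 0 d] x
  = \det (x%:M - map_mx f M).
Proof.
have -> : \det (x%:M - map_mx f M) = (map_poly f (char_poly M)).[x].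
  rewrite map_char_poly /char_poly -horner_evalE -det_map_mx.
  congr (\det _); apply/matrixP => i j; rewrite !mxE /= horner_evalE.
  by rewrite hornerD hornerN hornerC hornerMn hornerX.
rewrite (@horner_coef_wide _ d.+1); last by rewrite map_char_poly size_char_poly.
rewrite big_ord_recr /= addrC /monic_horner size_map size_iota.
have lcM := monicP (char_poly_monic M); rewrite lead_coefE size_char_poly in lcM.
rewrite coef_map /= lcM rmorph1 mul1r; congr (_ + _); apply: eq_bigr => j _.
by rewrite coef_map /= (nth_map 0%N) ?size_iota // nth_iota.
Qed.

(* The adjugate of [x%:M - M] turns the relations [x p_i = \sum_j M_ij p_j]   *)
(* modulo I into [\det (x%:M - M) * p_i] in I; the p_i generate 1.            *)
Lemma finite_integral (R S : comNzRingType) (f : {rmorphism R -> S}) (I : ideal S)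
    d (p : 'I_d -> S) :
  (forall s, exists c : 'I_d -> R, s - \sum_j f (c j) * p j \in I) ->
  forall x, exists c : seq R, monic_horner f c x \in I.
Proof.
move=> gen x; have [M xp] := fin_all_exists (fun i => gen (x * p i)).
pose A : 'M[R]_d := \matrix_(i, j) M i j.
exists [seq (char_poly A)`_j | j <- iota 0 d]; rewrite monic_horner_char_poly.
set N := _ - _.
have Np i : \sum_j N i j * p j \in I.
  have -> // : \sum_j N i j * p j = x * p i - \sum_j f (M i j) * p j.
  rewrite (eq_bigr (fun j => (x *+ (i == j)) * p j - f (M i j) * p j)); last first.
    by move=> j _; rewrite !mxE mulrBl.
  rewrite big_split /= sumrN; congr (_ - _).
  rewrite (bigD1 i) //= eqxx big1 ?addr0 // => j.
  by rewrite eq_sym => /negPf ->; rewrite mul0r.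
have dp i : \det N * p i \in I.
  have -> : \det N * p i = \sum_j (\adj N) i j * \sum_l N j l * p l.
    under eq_bigr do rewrite mulr_sumr.
    rewrite exchange_big /= (bigD1 i) //= [X in _ = _ + X]big1 ?addr0 => [|l neq_li].
      under eq_bigr do rewrite mulrA.
      rewrite -mulr_suml; congr (_ * _).
      by have /matrixP/(_ i i) := mul_adj_mx N; rewrite !mxE eqxx.
    under eq_bigr do rewrite mulrA.
    rewrite -mulr_suml; have /matrixP/(_ i l) := mul_adj_mx N.
    by rewrite !mxE eq_sym (negPf neq_li) => ->; rewrite mul0r.
  exact: idealr_sum.
have [c c1] := gen 1.
have -> : \det N = \det N * (1 - \sum_j f (c j) * p j) + \sum_j f (c j) * (\det N * p j).
  under [X in _ + X]eq_bigr do rewrite mulrCA.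
  by rewrite -mulr_sumr mulrBr mulr1 subrK.
by rewrite rpredD ?idealr_sum ?ideal_mull.
Qed.

(** * From quotient rings to representatives and back *)

Section QuotientAlgebra.
Variables (R S : comPzRingType) (f : {rmorphism R -> S}) (I : ideal S).

Lemma quot_proj_monic_horner (c : seq R) (x : S) :
  quot_proj I (monic_horner f c x)
  = monic_horner (quot_map f I) (map (quot_proj _) c) (quot_proj I x).
Proof.
rewrite /monic_horner rmorphD rmorphXn /= size_map; congr (_ + _).
rewrite rmorph_sum; apply: eq_bigr => j _.
by rewrite rmorphM rmorphXn (nth_map 0) // quot_map_proj.
Qed.

(** Lifting to congruences modulo [I] moves the problem from [A], possibly a zero ring, to
    polynomial rings, where characteristic polynomials exist. *)
Lemma finite_quot_gen : finite_module (module_via (quot_map f I)) ->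
  exists d (p : 'I_d -> S),
    forall s, exists c : 'I_d -> R, s - \sum_j f (c j) * p j \in I.
Proof.
case=> s gen; exists (size s), (fun j => quot_repr (s`_j : quot_ring I)) => x.
have [c xc] := gen (quot_proj I x); exists (fun j => quot_repr (c j)).
apply/eq_idealP; rewrite [LHS]xc rmorph_sum; apply: eq_bigr => j _.
by rewrite rmorphM /= -quot_map_proj !quot_reprK.
Qed.

(** The index type is arbitrary because the generators found below are indexed by monomials of
    bounded degree; enumerating [J] yields the list that [finite_module] asks for. *)
Lemma gen_finite_quot (J : finType) (p : J -> S) :
  (forall s, exists c : J -> R, s - \sum_j f (c j) * p j \in I) ->
  finite_module (module_via (quot_map f I)).
Proof.
move=> gen; pose q j : module_via (quot_map f I) := quot_proj I (p j).
exists [seq q j | j <- enum J] => v; have [c vc] := gen (quot_repr (v : quot_ring I)).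
have cardJ : size [seq q j | j <- enum J] = #|J| by rewrite size_map -cardE.
exists (fun i => quot_proj _ (c (enum_val (cast_ord cardJ i)))).
have -> : v = \sum_j quot_proj (contraction f I) (c j) *: q j.
  rewrite -[LHS](quot_reprK (v : quot_ring I)).
  have /eq_idealP -> := vc; rewrite rmorph_sum; apply: eq_bigr => j _.
  by rewrite rmorphM /= -quot_map_proj.
rewrite (reindex (fun i => enum_val (cast_ord cardJ i))) /=; last first.
  apply: onW_bij; apply: (bij_comp (@enum_val_bij J)).
  by exists (cast_ord (esym cardJ)); [apply: cast_ordK | apply: cast_ordKV].
apply: eq_bigr => i _; set j := cast_ord _ _.
rewrite (nth_map (enum_val j)); last by rewrite -(size_map q) ltn_ord.
by congr (_ *: q _); apply: enum_val_nth.
Qed.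

End QuotientAlgebra.

(** * The block order *)

Section BlockOrder.
Variables m n : nat.
Implicit Types u v : 'X_{1..m + n}.

Lemma block_mnmP u v : xpart u = xpart v -> ypart u = ypart v -> u = v.
Proof.
move=> /mnmP eqx /mnmP eqy; apply/mnmP => l; case: (split_ordP l) => j ->.
  by have := eqy j; rewrite !mnmE.
by have := eqx j; rewrite !mnmE.
Qed.

Lemma xpartD u v : xpart (u + v)%MM = (xpart u + xpart v)%MM.
Proof. by apply/mnmP => i; rewrite !mnmE. Qed.

Lemma ypartD u v : ypart (u + v)%MM = (ypart u + ypart v)%MM.
Proof. by apply/mnmP => i; rewrite !mnmE. Qed.

Lemma block_orderP (Tx : rel 'X_{1..n}) (Ty : rel 'X_{1..m}) :
  monomial_order Tx -> monomial_order Ty -> monomial_order (block_order Tx Ty).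
Proof.
move=> hTx hTy; case: (hTx) => xtot xanti xtr x0 xD; case: (hTy) => ytot yanti ytr y0 yD.
rewrite /block_order; split.
- by move=> u v; case: (eqVneq (xpart u) (xpart v)) => _.
- move=> u v; case: (eqVneq (xpart u) (xpart v)) => [eq|ne]; last first.
    by move=> /xanti eq; rewrite eq eqxx in ne.
  by move=> /yanti; apply: block_mnmP.
- move=> v u w; case: (eqVneq (xpart u) (xpart v)) => [->|ne].
    by case: ifP => // _; exact: ytr.
  case: (eqVneq (xpart v)) => [<-|ne']; first by rewrite (negPf ne).
  (* If [u] and [w] had the same x-part, it would compare both ways with that of [v], and
     antisymmetry would contradict [ne]. *)
  case: (eqVneq (xpart u)) => [equw|_]; last exact: xtr.
  rewrite equw => Twv Tvw; rewrite equw in ne.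
  by case/eqP: ne; apply: xanti; rewrite Twv.
- move=> u; have -> : xpart (0%MM : 'X_{1..m + n}) = 0%MM by apply/mnmP => i; rewrite !mnmE.
  have -> : ypart (0%MM : 'X_{1..m + n}) = 0%MM by apply/mnmP => i; rewrite !mnmE.
  by case: ifP.
- move=> u v w; rewrite !xpartD !ypartD eqm_add2r.
  by case: ifP => _; [exact: yD | exact: xD].
Qed.

End BlockOrder.

(** * Polynomials in two blocks of variables *)

Section Blocks.
Variables (m n : nat) (K : fieldType).
Local Notation S := {mpoly K[m + n]}.
Local Notation yincl := (yincl m n K).
Local Notation X i := ('X_(rshift m i) : S).
Implicit Types (u v w : 'X_{1..m + n}) (i : 'I_n).

Definition xincl : {rmorphism {mpoly K[n]} -> S} :=
  comp_mpoly [tuple 'X_(rshift m i) | i < n].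

Lemma yinclZ a p : yincl (a *: p) = a *: yincl p.
Proof. exact: comp_mpolyZ. Qed.

Lemma xpart_sum (J : Type) (r : seq J) (F : J -> 'X_{1..m + n}) :
  xpart (\sum_(j <- r) F j)%MM = (\sum_(j <- r) xpart (F j))%MM.
Proof.
by apply/mnmP => i; rewrite mnmE !mnm_sumE; apply: eq_bigr => j _; rewrite mnmE.
Qed.

Lemma xpart_x i d : xpart (U_(rshift m i) *+ d : 'X_{1..m + n})%MM = (U_(i) *+ d)%MM.
Proof. by apply/mnmP => j; rewrite mnmE !mulmnE !mnmE eq_rshift. Qed.

Lemma ypart_x i d : ypart (U_(rshift m i) *+ d : 'X_{1..m + n})%MM = 0%MM.
Proof. by apply/mnmP => j; rewrite mnmE !mulmnE !mnmE eq_rlshift. Qed.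

Lemma xpart_y (j : 'I_m) d : xpart (U_(lshift n j) *+ d : 'X_{1..m + n})%MM = 0%MM.
Proof. by apply/mnmP => i; rewrite mnmE !mulmnE !mnmE eq_lrshift. Qed.

Lemma yinclX (u : 'X_{1..m}) : yincl 'X_[u] = 'X_[\sum_j U_(lshift n j) *+ u j].
Proof.
rewrite [LHS]comp_mpolyX -mprodXnE; apply: eq_bigr => j _.
by rewrite tnth_mktuple.
Qed.

Lemma xinclX (u : 'X_{1..n}) : xincl 'X_[u] = 'X_[\sum_i U_(rshift m i) *+ u i].
Proof.
rewrite [LHS]comp_mpolyX -mprodXnE; apply: eq_bigr => j _.
by rewrite tnth_mktuple.
Qed.

(** This splitting shows that the x-monomials generate [S] as a module over the polynomials in y. *)
Lemma mpolyX_block u : 'X_[u] = yincl 'X_[ypart u] * xincl 'X_[xpart u].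
Proof.
rewrite yinclX xinclX -mpolyXD [u in LHS]multinomUE_id big_split_ord /=.
by congr ('X_[_ + _]); apply: eq_bigr => j _; rewrite mnmE.
Qed.

Lemma xinclXn i d : xincl 'X_[U_(i) *+ d] = X i ^+ d.
Proof.
by rewrite mpolyXn mpolyX_block ypart_x xpart_x mpolyX0 rmorph1 mul1r.
Qed.

Lemma msupp_yincl (p : {mpoly K[m]}) w : w \in msupp (yincl p) -> xpart w = 0%MM.
Proof.
rewrite [yincl p]comp_mpolyEX => /msupp_sum_le /flattenP[s /mapP[u _ ->]].
move=> /msuppZ_le; rewrite -/(yincl 'X_[u]) yinclX => /mem_msuppXP <-.
by rewrite xpart_sum big1 // => j _; rewrite xpart_y.
Qed.

Variables (Tx : rel 'X_{1..n}) (Ty : rel 'X_{1..m}).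
Hypotheses (hTx : monomial_order Tx) (hTy : monomial_order Ty).
Local Notation T := (block_order Tx Ty).

(** Coefficients in y leave x-parts unchanged, so every monomial of the term of index [j < size c]
    has x-part [x_i^j]. The block order looks at x-parts first, so the top power wins whatever the
    coefficients are. *)
Lemma LM_monic_horner (c : seq {mpoly K[m]}) i :
  monic_horner yincl c (X i) != 0 /\
  LM T (monic_horner yincl c (X i)) = (U_(rshift m i) *+ size c)%MM.
Proof.
set p := monic_horner _ _ _; set A := (_ *+ size c)%MM.
pose t j := yincl c`_j * X i ^+ j.
have xt j w : w \in msupp (t j) -> xpart w = (U_(i) *+ j)%MM.
  rewrite /t mpolyXn (perm_mem (msuppMX _ _)) => /mapP[v /msupp_yincl xv ->].
  by rewrite xpartD xv addm0 xpart_x.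
have neqU j : (j < size c)%N -> (U_(i) *+ j != U_(i) *+ size c)%MM.
  move=> lt_jc; apply: contraTneq lt_jc => /mnmP/(_ i).
  by rewrite !mulmnE mnm1E eqxx !mul1n => ->; rewrite ltnn.
have pA : A \in msupp p.
  rewrite mcoeff_msupp mcoeffD mcoeffXn eqxx raddf_sum big1 ?addr0 ?oner_eq0 //= => j _.
  apply/eqP; rewrite mcoeff_eq0; apply/negP => /xt; rewrite xpart_x => /esym/eqP.
  by apply/negP/neqU.
split; first by rewrite -msupp_eq0; case: (msupp p) pA.
apply: LM_unique => // [|w]; first exact: block_orderP.
rewrite /p /monic_horner mpolyXn => /msuppD_le; rewrite mem_cat => /orP[|].
  by move=> /mem_msuppXP <-; apply/monomial_order_refl/block_orderP.
move=> /msupp_sum_le /flattenP[s /mapP[j _ ->]] /xt xw.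
rewrite /block_order xw xpart_x (negPf (neqU _ _)) //.
apply: monomial_order_lem => //; apply/mnm_lepP => l.
by rewrite !mulmnE leq_mul // ltnW.
Qed.

(** A power of [x_i] has the least possible y-part, so nothing lies strictly below it with the same
    x-part: the descent already shows in the x-part. *)
Lemma block_strict_xpart w i d (A := (U_(rshift m i) *+ d)%MM : 'X_{1..m + n}) :
  T w A -> w != A -> strict_order Tx (xpart w) (U_(i) *+ d)%MM.
Proof.
rewrite /strict_order /block_order xpart_x ypart_x; case: eqVneq => [eqx|_ ->] //.
case: hTy => _ Tanti _ T0 _ Tw0 /eqP[]; apply: block_mnmP.
  by rewrite xpart_x.
by rewrite ypart_x; apply: Tanti; rewrite T0 Tw0.
Qed.

(** * Finiteness, integrality and leading powers *)

Variable I : ideal S.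

Lemma xpower_gen :
  (forall i, exists g : S, [/\ g \in I, g != 0 & is_xpower i (LM T g)]) ->
  exists B, forall s : S, exists c : 'X_{1..n < B} -> {mpoly K[m]},
    s - \sum_b yincl (c b) * xincl 'X_[b] \in I.
Proof.
move=> /fin_all_exists[g gP].
have /fin_all_exists[a LMg] : forall i, exists d, LM T (g i) = (U_(rshift m i) *+ d)%MM.
  by move=> i; case: (gP i).
(* A coarse bound: by pigeonhole, a monomial of degree at least [B] is divisible by some
   [x_i^(a i)]. All x-monomials of smaller degree serve as generators, even the reducible ones. *)
exists (\sum_i a i).+1; set B := _.+1.
pose gen (s : S) := exists c : 'X_{1..n < B} -> {mpoly K[m]},
  s - \sum_b yincl (c b) * xincl 'X_[b] \in I.
have genI s : s \in I -> gen s.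
  by exists (fun=> 0); rewrite big1 ?subr0 // => b _; rewrite rmorph0 mul0r.
have genD s1 s2 : gen s1 -> gen s2 -> gen (s1 + s2).
  move=> [c1 I1] [c2 I2]; exists (fun b => c1 b + c2 b).
  under eq_bigr do rewrite rmorphD mulrDl.
  by rewrite big_split opprD addrACA rpredD.
have genM r s : gen s -> gen (yincl r * s).
  move=> [c Is]; exists (fun b => r * c b).
  under eq_bigr do rewrite rmorphM -mulrA.
  by rewrite -mulr_sumr -mulrBr ideal_mull.
have gen_sum (J : eqType) (r : seq J) (P : pred J) (F : J -> S) :
    (forall j, j \in r -> P j -> gen (F j)) -> gen (\sum_(j <- r | P j) F j).
  move=> genF; rewrite big_seq_cond; apply: big_ind => //; first exact/genI/rpred0.
  by move=> j /andP[]; apply: genF.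
suff genx (u : 'X_{1..n}) : gen (xincl 'X_[u]).
  move=> s; rewrite [s]mpolyE; apply: gen_sum => u _ _.
  by rewrite mpolyX_block scalerAl -yinclZ; apply: genM.
elim/(well_founded_ind (strict_order_wf hTx)): u => u IH.
have [ltuB|leBu] := ltnP (mdeg u) B.
  pose bu : 'X_{1..n < B} := BMultinom ltuB.
  exists (fun b => (b == bu)%:R); rewrite (bigD1 bu) //= eqxx rmorph1 mul1r.
  by rewrite big1 ?addr0 ?subrr ?rpred0 // => b /negPf ->; rewrite rmorph0 mul0r.
have [i le_au] : exists i, (a i <= u i)%N.
  apply/existsP; apply: contraTT leBu => /existsPn lt_ua.
  by rewrite -ltnNge ltnS mdegE leq_sum // => i _; rewrite ltnW // ltnNge.
have [Ig nzg _] := gP i; move/(_ i): LMg; move: (g i) Ig nzg => p Ig nzg.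
set A := LM T p => LMp; have T_block := block_orderP hTx hTy.
have nzA : p@_A != 0 by rewrite -mcoeff_msupp LM_msupp.
pose v := (u - U_(i) *+ a i)%MM.
have uE : u = (v + U_(i) *+ a i)%MM.
  rewrite submK //; apply/mnm_lepP => l; rewrite mulmnE mnm1E.
  by case: eqVneq => [<-|_]; rewrite ?mul1n.
(* One division step: ['X_[u]] is a multiple of [p], normalised by its leading coefficient, minus
   the shifted tail of [p]. *)
have -> : xincl 'X_[u] = ((p@_A)^-1 *: xincl 'X_[v]) * p
    + \sum_(w <- msupp p | w != A) - ((p@_A)^-1 * p@_w) *: (xincl 'X_[v] * 'X_[w]).
  rewrite [p in _ * p + _]mpolyE (bigD1_seq A) ?msupp_uniq ?LM_msupp //=.
  rewrite mulrDr -scalerAl -scalerAr scalerA mulVf // scale1r -addrA.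
  rewrite mulr_sumr -big_split big1 /= => [|w _].
    by rewrite addr0 uE mpolyXD rmorphM xinclXn mpolyXn -LMp.
  by rewrite -scalerAl -scalerAr scalerA scaleNr subrr.
apply: genD; first by apply/genI/ideal_mull.
apply: gen_sum => w pw neq_wA.
(* The y-part of [w] joins the coefficient. The remaining x-monomial [v + xpart w] is strictly below
   [u], since [xpart w] is strictly below [x_i^(a i)]. *)
rewrite mpolyX_block mulrCA -rmorphM -mpolyXD scalerAl -yinclZ; apply/genM/IH.
rewrite uE addmC [(v + _)%MM]addmC; apply: strict_orderD => //.
apply: block_strict_xpart; rewrite -LMp //.
exact: LM_max.
Qed.

(** Condition (2) on representatives: the monic relations become elements of [I], which have leading
    monomials. *)
Definition integral_xs :=
  forall i, exists c : seq {mpoly K[m]}, monic_horner yincl c (X i) \in I.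

Definition has_xpower_leads (G : seq S) :=
  forall i, exists g : S, [/\ g \in G, g != 0 & is_xpower i (LM T g)].

Lemma finite_integral_xs : finite_module (Bmod I) -> integral_xs.
Proof. by move=> /finite_quot_gen[d [p gen]] i; apply: (finite_integral gen). Qed.

Lemma integral_xsP : integral_xs <->
  exists phi : 'I_n -> seq (ringA I),
    forall i, monic_horner (structAB I) (phi i) (xclass I i) = 0.
Proof.
split=> [/fin_all_exists[c cI]|[phi phi0] i].
  exists (fun i => map (quot_proj _) (c i)) => i.
  rewrite -quot_proj_monic_horner -(rmorph0 (quot_proj I)).
  by apply/eq_idealP; rewrite subr0.
exists (map (@quot_repr _ _) (phi i)); rewrite -[_ _ _ _]subr0; apply/eq_idealP.
rewrite rmorph0 quot_proj_monic_horner -[RHS](phi0 i) -map_comp map_id_in // => a _.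
exact: quot_reprK.
Qed.

Lemma integral_xs_LM (G : seq S) :
  groebner_basis T I G -> integral_xs -> has_xpower_leads G.
Proof.
case=> _ div int i; have [c cI] := int i.
have [nz LMc] := LM_monic_horner c i.
have := div _ cI nz; rewrite LMc => /ideal_span_mpolyX[g].
rewrite mem_filter => /andP[nzg Gg] le_g; exists g; split=> //.
(* Dividing a power of [x_i] forces all other exponents to be 0, so the exponent in [x_i] determines
   the monomial. *)
exists (LM T g (rshift m i)); apply/mnmP => l; rewrite mulmnE mnm1E.
case: eqVneq => [<-|ne]; rewrite ?mul1n //; apply/eqP.
by have /mnm_lepP/(_ l) := le_g; rewrite mulmnE mnm1E (negPf ne) leqn0.
Qed.

Lemma LM_finite (G : seq S) :
  groebner_basis T I G -> has_xpower_leads G -> finite_module (Bmod I).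
Proof.
case=> GI _ pow; have [|B gen] := xpower_gen; last exact: gen_finite_quot gen.
by move=> i; have [g [Gg nzg xg]] := pow i; exists g; split=> //; apply: GI.
Qed.

(** The only candidate for [alpha] is the monomial's own exponent in [x_i], so the test checks one
    equation instead of searching. *)
Lemma finiteness_testP (G : seq S) : finiteness_test Tx Ty G <-> has_xpower_leads G.
Proof.
split=> [/forallP test i|pow].
  have /hasP[g Gg /andP[nzg /eqP LMg]] := test i; exists g; split=> //.
  by exists (LM T g (rshift m i)).
apply/forallP => i; apply/hasP; have [g [Gg nzg [d LMg]]] := pow i.
by exists g => //=; rewrite nzg LMg mulmnE mnm1E eqxx mul1n /=.
Qed.

End Blocks.

Theorem corollary5p2 (k : effective_field) (m n : nat)
    (I : ideal {mpoly k[m + n]})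
    (Tx : rel 'X_{1..n}) (Ty : rel 'X_{1..m})
    (hTx : monomial_order Tx) (hTy : monomial_order Ty)
    (G : seq {mpoly k[m + n]})
    (hG : groebner_basis (block_order Tx Ty) I G) :
  (forall F : seq {mpoly k[m + n]}, (forall p, p \in I <-> ideal_span F p) ->
     (finite_module (Bmod I) <->
      finiteness_test Tx Ty (groebner (block_order Tx Ty) F))) /\
  (finite_module (Bmod I) <->
   exists phi : 'I_n -> seq (ringA I),
     forall i : 'I_n, monic_horner (structAB I) (phi i) (xclass I i) = 0) /\
  (finite_module (Bmod I) <->
   forall i : 'I_n, exists g : {mpoly k[m + n]},
     [/\ g \in G, g != 0 & is_xpower i (LM (block_order Tx Ty) g)]).
Proof.
(* Stated for any Gröbner basis, as it serves both the given [G] and the one computed from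
   generators [F]. *)
have leadsP G' : groebner_basis (block_order Tx Ty) I G' ->
    (finite_module (Bmod I) <-> has_xpower_leads Tx Ty G').
  move=> hG'; split; last exact: LM_finite hG'.
  by move=> /finite_integral_xs; apply: integral_xs_LM hG'.
split=> [F FI|].
  have := leadsP _ (groebnerP (block_orderP hTx hTy) FI).
  by move=> ->; apply: iff_sym; apply: finiteness_testP.
split; last exact: leadsP.
rewrite -integral_xsP; split; first exact: finite_integral_xs.
(* (2) implies (1) by way of (3). *)
by move=> int; apply: (LM_finite hTx hTy hG); apply: integral_xs_LM hG int.
Qed.
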